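(* Let $\{P_1,\ldots,P_r\}$ be a stable weighted set over a field $F$, with coefficients $\mu_i\in F$ and characteristic numbers $a_1^{(i)},\ldots,a_n^{(i)}\in F$ ($1\le i\le r$). If there exists a partition $\lambda=(1^{m_1(\lambda)}2^{m_2(\lambda)}\cdots n^{m_n(\lambda)})$ of weight $n$ such that $m(\lambda)\geq r$, then $$\Gamma(\lambda)=\sum_{i=1}^{r}\mu_i\cdot a_{\lambda}^{(i)}=0.$$
   Context: $F$ is a field (finite or infinite), and $r,n$ are positive integers. A set of $r$ elements $\{P_1,\ldots,P_r\}$ is called a weighted set over $F$ if to each $P_i$ ($1\le i\le r$) there are associated $n+1$ elements $\mu_i,a_1^{(i)},\ldots,a_n^{(i)}$ of $F$; $\mu_i$ is the coefficient of $P_i$ and $a_1^{(i)},\ldots,a_n^{(i)}$ are the characteristic numbers of $P_i$ (no distinctness or nonvanishing is required). A partition of weight $w$ is $\lambda=(1^{m_1(\lambda)}2^{m_2(\lambda)}\cdots n^{m_n(\lambda)})$, where $m_1(\lambda),\ldots,m_n(\lambda)$ are non-negative integers with $\sum_{j=1}^n j\cdot m_j(\lambda)=w$. Put $m(\lambda):=\max\{m_1(\lambda),\ldots,m_n(\lambda)\}$, $a_\lambda^{(i)}:=\prod_{j=1}^n (a_j^{(i)})^{m_j(\lambda)}$ (with $x^0=1$ for all $x \in F$), and $\Gamma(\lambda):=\sum_{i=1}^r\mu_i\cdot a_\lambda^{(i)}\in F$. The weighted set is called stable if $\Gamma(\lambda)=0$ for every integer $w$ with $0\le w<n$ and every partition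 $\lambda=(1^{m_1(\lambda)}\cdots n^{m_n(\lambda)})$ of weight $w$. *)

(* Defs.v *)
From mathcomp Require Import all_boot all_algebra.

Set Implicit Arguments.
Unset Strict Implicit.
Unset Printing Implicit Defensive.

Import GRing.Theory.
Local Open Scope ring_scope.

(* The points P_1, ..., P_r are indexed by 'I_r; as indices start at 0,
   [charnum W i j] is the characteristic number a_(j+1) of the point i. *)
Record weighted_set (F : fieldType) (r n : nat) := WeightedSet {
  coef : 'I_r -> F;
  charnum : 'I_r -> 'I_n -> F
}.

(* A partition (1^m_1 2^m_2 ... n^m_n) is given by its multiplicities:
   [l j] is the multiplicity m_(j+1) of the part j+1. *)
Definition multiplicities (n : nat) := {ffun 'I_n -> nat}.

Definition weight (n : nat) (l : multiplicities n) : nat :=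
  (\sum_(j < n) j.+1 * l j)%N.

Definition max_multiplicity (n : nat) (l : multiplicities n) : nat :=
  (\max_(j < n) l j)%N.

Definition char_monomial (F : fieldType) (r n : nat) (W : weighted_set F r n)
    (l : multiplicities n) (i : 'I_r) : F :=
  \prod_(j < n) charnum W i j ^+ l j.

Definition Gamma (F : fieldType) (r n : nat) (W : weighted_set F r n)
    (l : multiplicities n) : F :=
  \sum_(i < r) coef W i * char_monomial W l i.

Definition stable (F : fieldType) (r n : nat) (W : weighted_set F r n) : Prop :=
  forall (w : nat), (w < n)%N ->
  forall l : multiplicities n, weight l = w -> Gamma W l = 0.

(* Main.v *)
Require Import Defs.
From mathcomp Require Import all_boot all_algebra.

(** Pick a part [j] whose multiplicity in [l] is maximal, hence at least [r],
    and let [x i] be the corresponding characteristic number of the point [i].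
    Freezing the other multiplicities of [l], the sum [Gamma] becomes a weighted
    power sum [\sum_i b i * x i ^+ k] of the multiplicity [k] of [j].  Lowering
    [k] below [l j] lowers the weight below [n], so stability makes this sum
    vanish for all [k < l j], in particular for the [r] exponents [k < r].  But
    the power sums of [r] points satisfy a linear recurrence of order [r], given
    by the polynomial with roots [x i]; so all of them vanish, including the
    one with [k = l j], which is [Gamma W l]. *)

Import GRing.Theory.
Local Open Scope ring_scope.

(** Every power of ['X] agrees at the [r] points [x i] with its remainder modulo
    [\prod_i ('X - (x i)%:P)], which is a combination of [1, 'X, ..., 'X^(r-1)].
    The points may coincide. *)
Lemma weighted_power_sum_eq0 (F : fieldType) (r : nat) (b x : 'I_r -> F) :
    (forall k, (k < r)%N -> \sum_(i < r) b i * x i ^+ k = 0) ->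
  forall m, \sum_(i < r) b i * x i ^+ m = 0.
Proof.
move=> low m; pose P := \prod_(i < r) ('X - (x i)%:P).
have sizeP : size P = r.+1.
  by rewrite size_prod_XsubC [index_enum _]unlock -enumT size_enum_ord.
have sz : (size ('X^m %% P)%R <= r)%N.
  by rewrite -ltnS -sizeP ltn_modp -size_poly_eq0 sizeP.
have ev i : x i ^+ m = \sum_(k < r) ('X^m %% P)%R`_k * x i ^+ k.
  rewrite -(horner_coef_wide _ sz) -hornerXn {1}(divp_eq 'X^m P).
  suff Px0 : P.[x i] = 0 by rewrite hornerD hornerM Px0 mulr0 add0r.
  by rewrite horner_prod (bigD1 i) //= hornerXsubC subrr mul0r.
under eq_bigr => i _ do rewrite ev big_distrr /=.
rewrite exchange_big big1 //= => k _.
under eq_bigr => i _ do rewrite mulrCA.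
by rewrite -big_distrr low //= mulr0.
Qed.

Definition set_multiplicity {n : nat} (l : multiplicities n) (j : 'I_n)
    (k : nat) : multiplicities n :=
  [ffun t => if t == j then k else l t].

Lemma set_multiplicity_id (n : nat) (l : multiplicities n) (j : 'I_n) :
  set_multiplicity l j (l j) = l.
Proof. by apply/ffunP => t; rewrite ffunE; case: eqP => [->|]. Qed.

Lemma ltn_weight_set_multiplicity (n : nat) (l : multiplicities n) (j : 'I_n)
    (k : nat) :
  (k < l j)%N -> (weight (set_multiplicity l j k) < weight l)%N.
Proof.
move=> klt; rewrite /weight (bigD1 j) //= [ltnRHS](bigD1 j) //= ffunE eqxx.
rewrite (eq_bigr (fun t : 'I_n => (t.+1 * l t)%N)) => [|t tj].
  by rewrite ltn_add2r ltn_pmul2l.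
by rewrite ffunE (negPf tj).
Qed.

Lemma Gamma_set_multiplicity (F : fieldType) (r n : nat)
    (W : weighted_set F r n) (l : multiplicities n) (j : 'I_n) (k : nat) :
  Gamma W (set_multiplicity l j k) =
    \sum_(i < r) (coef W i * \prod_(t < n | t != j) charnum W i t ^+ l t)
                   * charnum W i j ^+ k.
Proof.
apply: eq_bigr => i _; rewrite -mulrA; congr (_ * _).
rewrite /char_monomial (bigD1 j) //= ffunE eqxx mulrC; congr (_ * _).
by apply: eq_bigr => t tj; rewrite ffunE (negPf tj).
Qed.

Theorem proposition1p1 (F : fieldType) (r n : nat) (hr : (0 < r)%N)
    (hn : (0 < n)%N) (W : weighted_set F r n) (hW : stable W)
    (l : multiplicities n) (hweight : weight l = n)
    (hmax : (r <= max_multiplicity l)%N) :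
  Gamma W l = 0.
Proof.
have [|j maxj] := @eq_bigmax 'I_n l; first by rewrite card_ord.
rewrite /max_multiplicity maxj in hmax.
rewrite -(set_multiplicity_id _ l j) Gamma_set_multiplicity.
apply: weighted_power_sum_eq0 => k kr; rewrite -Gamma_set_multiplicity.
apply: (hW (weight (set_multiplicity l j k))) => //.
by rewrite -[ltnRHS]hweight ltn_weight_set_multiplicity // (leq_trans kr).
Qed.
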